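(* For every positive integer $n$, \[ \frac14\log_2(n+1)\le \breve w_{2,n}\le \frac14[\log_2 n]+\frac34, \] where $[x]$ denotes the largest integer not exceeding $x$. In particular, \[ \lim_{n\to\infty}\frac{\breve w_{2,n}}{\log_2 n}=\frac14 . \]
   Context: $\mathcal{K}^n$ denotes the class of $n$-dimensional convex bodies, i.e. compact convex subsets of $\mathbb{R}^n$ with nonempty interior. For $K\in\mathcal{K}^n$, $C(K)$ is the space of continuous real-valued functions on $K$ with norm $\|f\|_K=\max_{x\in K}|f(x)|$, and $\breve C(K)$ is the set of those $f\in C(K)$ that are convex on $K$, i.e. satisfy $f(x)+f(y)\ge 2f((x+y)/2)$ for all $x,y\in K$. $\mathcal{P}_{m,n}$ is the space of real algebraic polynomials of total degree $\le m$ in $n$ variables. For $f\in C(K)$, \[ E_m(f;K)=\inf_{P\in\mathcal{P}_{m,n}}\|f-P\|_K, \] and the $m$-th modulus of smoothness is \[ \omega_m(f;K)=\max_{x,x+h,\dots,x+mh\in K}|\Delta_h^m(f;x)|,\qquad \Delta_h^m(f;x)=\sum_{j=0}^m(-1)^j\binom mj f(x+jh), \] the maximum being over all $x,h\in\mathbb{R}^n$ with $x,x+h,\dots,x+mh\in K$. The Whitney constant for convex functions is \[ \breve w_m(K)=\sup\{E_{m-1}(f;K): f\in\breve C(K),\ \omega_m(f;K)\le 1\}, \] and the corresponding global constant is $\breve w_{m,n}=\sup_{K\in\mathcal{K}^n}\breve w_m(K)$. *)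

(* Defs.v *)
From mathcomp Require mpoly.
From mathcomp Require Import all_boot all_order all_algebra.
From mathcomp Require Import all_classical all_reals all_analysis.

Set Implicit Arguments.
Unset Strict Implicit.
Unset Printing Implicit Defensive.

Import Order.TTheory GRing.Theory Num.Theory.
Import numFieldNormedType.Exports.
(* Its notations clash with those of the analysis library. *)
Import -(notations) mpoly.

Local Open Scope classical_set_scope.
Local Open Scope ring_scope.

(* All the suprema and infima below are taken in [\bar R], so that they are
   meaningful without any boundedness side condition.  [R^n] is ['rV[R]_n]
   with its product topology (the library norm on it is the max norm). *)

Section WhitneyConstants.
Context {R : realType}.

Definition convex_body n (K : set 'rV[R]_n) : Prop :=
  [/\ compact K, convex_set K & interior K !=set0].

(* A function on [K] is represented by a function on the whole space; only its
   values on [K] are used, here and in the definitions below. *)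
Definition convex_continuous n (K : set 'rV[R]_n) (f : 'rV[R]_n -> R) : Prop :=
  {within K, continuous f} /\
  forall x y, K x -> K y -> f x + f y >= 2 * f (2^-1 *: (x + y)).

(* For continuous [f] and compact nonempty [K] the supremum is attained. *)
Definition sup_norm n (K : set 'rV[R]_n) (f : 'rV[R]_n -> R) : \bar R :=
  ereal_sup [set `|f x|%:E | x in K].

(* [mpoly.msize P] is the total degree of [P] plus one (and [0] if [P = 0]). *)
Definition poly_deg_le m n : set (mpoly.mpoly n R) :=
  [set P | (mpoly.msize P <= m.+1)%N].

Definition mpoly_fun n (P : mpoly.mpoly n R) (x : 'rV[R]_n) : R :=
  mpoly.meval (x 0) P.

Definition best_approx m n (K : set 'rV[R]_n) (f : 'rV[R]_n -> R) : \bar R :=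
  ereal_inf [set sup_norm K (fun x => f x - mpoly_fun P x)
            | P in @poly_deg_le m n].

Definition finite_diff m n (h : 'rV[R]_n) (f : 'rV[R]_n -> R) (x : 'rV[R]_n)
    : R :=
  \sum_(j < m.+1) (-1) ^+ j * 'C(m, j)%:R * f (x + h *+ j).

Definition modulus_smoothness m n (K : set 'rV[R]_n) (f : 'rV[R]_n -> R)
    : \bar R :=
  ereal_sup [set `|finite_diff m xh.2 f xh.1|%:E
            | xh in [set xh : 'rV[R]_n * 'rV[R]_n |
                     forall j : nat, (j <= m)%N -> K (xh.1 + xh.2 *+ j)]].

(* Meaningful for [m >= 1]. *)
Definition convex_whitney m n (K : set 'rV[R]_n) : \bar R :=
  ereal_sup [set best_approx m.-1 K f
            | f in [set f : 'rV[R]_n -> R |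
                    convex_continuous K f /\
                    (modulus_smoothness m K f <= 1)%E]].

Definition log2 (x : R) : R := ln x / ln 2.

End WhitneyConstants.

Definition global_convex_whitney (R : realType) (m n : nat) : \bar R :=
  ereal_sup [set convex_whitney m K | K in @convex_body R n].

(* Main.v *)
Require Import Defs.
From mathcomp Require mpoly.
From mathcomp Require Import all_boot all_order all_algebra.
From mathcomp Require Import all_classical all_reals all_analysis.
From mathcomp Require Import ring lra zify.

Import Order.TTheory GRing.Theory Num.Theory.
Import numFieldNormedType.Exports.

Local Open Scope classical_set_scope.
Local Open Scope ring_scope.

(** Approximating a convex function [f] on [K] by affine functions is governed
    by its Jensen gap, the largest value of [sum_i t_i f x_i - f (sum_i t_i x_i)]
    over convex combinations in [K]: the error of best approximation is at most
    half of the gap, because a separation argument slides an affine function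
    between [f] and the concave envelope of [f] lowered by the gap.

    _Upper bound._ [omega_2 f <= 1] says that [- f] is midpoint convex up to an
    error [1/2].  To bound the gap for a combination of [N <= 2 ^ m] points, read
    the weights in binary: a weighted mean with dyadic weights is the root of a
    binary tree of midpoints, in which every point is a leaf at depth [l] once
    for each binary digit [2 ^- l] of its weight (the Knuth-Yao tree that
    simulates a discrete law with coin tosses).  Each internal node costs at most
    [1/2], weighted by [2 ^- depth]; at depth [s] there are at most [2 ^ s] of
    them, and at most [N], so that the total is at most
    [1/2 * sum_s min (1, N / 2 ^ s) <= 1/2 * (m + 2)] ([tree_jensen],
    [tree_cost_le]).  Continuity extends this to all weights ([jensen_upto]).
    By Caratheodory's theorem [N = n + 1] points suffice, and half of the gap is
    then at most [(m + 2) / 4] for the least [m] with [n < 2 ^ m], that is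
    [m = floor (log2 n) + 1] ([global_convex_whitney_le]).

    _Lower bound._ On the simplex with barycentric coordinates [p_0, ..., p_n],
    half of the negative entropy, [1/2 * sum_i p_i log2 p_i], has a large gap.
    Its second differences are Jensen-Shannon divergences, which lie between 0
    and one bit; it vanishes at the vertices and equals [- 1/2 * log2 (n + 1)] at
    the centroid.  An affine function takes at the centroid the mean of its
    values at the vertices, so that it errs by at least a quarter of
    [log2 (n + 1)] somewhere ([global_convex_whitney_ge]).

    Both bounds divided by [log2 n] tend to [1/4]. *)

(** * Jensen's inequality for approximately midpoint convex functions *)

(** The closure of [K] under midpoints is part of the notion, so that the points
    built by repeated halving can be shown to stay in [K] along the way. *)
Definition midconvex_upto (R : realType) (V : lmodType R) (K : set V)
    (eps : R) (g : V -> R) : Prop :=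
  forall x y, K x -> K y ->
    K (2^-1 *: (x + y)) /\ g (2^-1 *: (x + y)) <= 2^-1 * (g x + g y) + eps.

(** The number of internal nodes at depth [s] of the midpoint tree, weighted by
    [2 ^- s], is at most both [1] and [N / 2 ^ s]. *)
Definition tree_cost (R : realType) (N L : nat) : R :=
  \sum_(s < L) Num.min 1 (N%:R / 2 ^+ s).

Section ApproximateJensen.
Context {R : realType} {V : lmodType R} (K : set V) (eps : R) (g : V -> R).
Context (gK : midconvex_upto R V K eps g).

(** One level of the midpoint tree: nodes may be paired arbitrarily, since only
    the sum of the values matters. *)
Lemma pair_up p (ys : seq V) : size ys = p.*2 -> {in ys, forall y, K y} ->
  exists zs : seq V, [/\ size zs = p, {in zs, forall z, K z},
    \sum_(z <- zs) z = 2^-1 *: \sum_(y <- ys) y &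
    \sum_(z <- zs) g z <= 2^-1 * \sum_(y <- ys) g y + eps * p%:R].
Proof.
elim: p ys => [|p IHp] ys; first by move/size0nil->; exists [::];
  split=> //; rewrite !big_nil ?scaler0 ?mulr0 ?addr0.
case: ys => [|y [|y' ys]] // /eqP; rewrite doubleS !eqSS => /eqP sz Kys.
have [u uys|zs [szz Kzs Ez lez]] := IHp _ sz.
  by apply: Kys; rewrite !inE uys !orbT.
have [Km lem] := gK y y' (Kys _ (mem_head _ _)) (Kys y' ltac:(by rewrite !inE eqxx orbT)).
exists (2^-1 *: (y + y') :: zs); split.
- by rewrite /= szz.
- by move=> z; rewrite inE => /orP[/eqP->|/Kzs].
- by rewrite !big_cons Ez -scalerDr addrA.
- by rewrite !big_cons -[p.+1%:R]natr1; lra.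
Qed.

(** Reading the last binary digit of each multiplicity [a i]: the points with an
    odd multiplicity join the list of nodes at the current depth. *)
Lemma sum_cat_odd N (x : 'I_N -> V) (a : 'I_N -> nat) ys (W : zmodType)
    (F : V -> W) :
  \sum_(y <- ys ++ [seq x i | i <- enum 'I_N & odd (a i)]) F y
    + \sum_i F (x i) *+ (a i)./2 *+ 2 =
  \sum_(y <- ys) F y + \sum_i F (x i) *+ a i.
Proof.
rewrite big_cat big_map big_filter big_enum_cond /= -addrA; congr (_ + _).
rewrite big_mkcond -big_split; apply: eq_bigr => i _ /=.
by rewrite -mulrnA muln2 -[in RHS](odd_double_half (a i)) mulrnDr; case: odd.
Qed.

Lemma size_cat_odd N (x : 'I_N -> V) (a : 'I_N -> nat) (ys : seq V) :
  (size (ys ++ [seq x i | i <- enum 'I_N & odd (a i)])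
    + (\sum_i (a i)./2).*2 = size ys + \sum_i a i)%N.
Proof.
rewrite size_cat size_map size_filter -sum1_count big_enum_cond /= -addnA.
congr (_ + _)%N; rewrite big_mkcond -muln2 big_distrl -big_split.
by apply: eq_bigr => i _ /=; rewrite muln2 -[RHS]odd_double_half; case: odd.
Qed.

(** The midpoint tree, built from its leaves upwards.  At depth [L] the nodes are
    the points of [ys], already formed by halving, together with [a i] copies of
    each [x i].  The odd copies are paired with [ys], the even ones are moved up
    to depth [L - 1] two by two.  The bound [size ys <= N] is the invariant that
    makes the cost small: from at most [2 * N] nodes the pairing produces at most
    [N]. *)
Lemma tree_jensen N (x : 'I_N -> V) : 0 <= eps -> (forall i, K (x i)) ->
  forall L (a : 'I_N -> nat) (ys : seq V), {in ys, forall y, K y} ->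
  (size ys <= N)%N -> (size ys + \sum_i a i = 2 ^ L)%N ->
  let S := \sum_(y <- ys) y + \sum_i x i *+ a i in
  K (2 ^- L *: S) /\
  g (2 ^- L *: S) <= 2 ^- L * (\sum_(y <- ys) g y + \sum_i g (x i) *+ a i)
    + eps * tree_cost R N L.
Proof.
move=> eps0 Kx; elim=> [|L IHL] a ys Kys szN sz S; rewrite {}/S;
  rewrite -(sum_cat_odd _ x a ys _ id) -(sum_cat_odd _ x a ys _ g);
  have := size_cat_odd _ x a ys; rewrite {}sz.
all: have : (size [seq x i | i <- enum 'I_N & odd (a i)] <= N)%N
  by rewrite size_map size_filter (leq_trans (count_size _ _)) ?size_enum_ord.
all: have : {in ys ++ [seq x i | i <- enum 'I_N & odd (a i)], forall y, K y}
  by move=> y; rewrite mem_cat => /orP[/Kys//|/mapP[i _ ->]].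
all: move=> Kys' szo.
all: have : (size (ys ++ [seq x i | i <- enum 'I_N & odd (a i)]) <= N.*2)%N
  by rewrite size_cat -addnn leq_add.
all: move: (ys ++ _) Kys' => zs Kzs szzs.
  (* At depth 0 there is a single node, the mean itself. *)
  rewrite expn0 => sz1.
  have a0 : (\sum_i (a i)./2 = 0)%N by lia.
  have aE i : (a i)./2 = 0%N.
    by apply/eqP; rewrite -leqn0 -a0 (bigD1 i)//= leq_addr.
  rewrite a0 addn0 in sz1.
  case: zs sz1 Kzs {szzs} => [|y [|]]//= _ Kzs.
  have S0 (W : zmodType) (F : V -> W) : \sum_i F (x i) *+ (a i)./2 *+ 2 = 0.
    by apply: big1 => i _; rewrite aE mulr0n mul0rn.
  rewrite !big_seq1 (S0 V id) (S0 R g) !addr0 expr0 invr1 scale1r mul1r.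
  rewrite /tree_cost big_ord0 mulr0 addr0.
  by split=> //; apply: Kzs; rewrite mem_seq1.
rewrite expnS mul2n => szE.
have [p pE] : exists p, size zs = p.*2.
  exists (2 ^ L - \sum_i (a i)./2)%N; rewrite doubleB; lia.
have [us [szu Kus Eu leu]] := pair_up p zs pE Kzs.
have [] := IHL (fun i => (a i)./2) us Kus _ _.
- by rewrite szu; lia.
- by rewrite szu; lia.
rewrite Eu => Ku gu.
have -> : \sum_(y <- zs) y + \sum_i x i *+ (a i)./2 *+ 2 =
  2 *: (2^-1 *: \sum_(y <- zs) y + \sum_i x i *+ (a i)./2).
  by rewrite sumrMnl scalerDr scalerA divff// scale1r scaler_nat.
rewrite !scalerA.
have -> : 2 ^- L.+1 * 2 = 2 ^- L :> R by rewrite exprS invfM mulrAC mulVf ?mul1r.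
split=> //; apply: (le_trans gu).
rewrite sumrMnl -[(\sum_i _) *+ 2]mulr_natr exprS invfM.
set A := \sum_(z <- us) _ in leu *; set B := \sum_(y <- zs) g y in leu *.
set C := \sum_i _ *+ _.
have e0 : 0 <= 2 ^- L :> R by rewrite invr_ge0 exprn_ge0.
(* The [p] pairs of this level cost [eps] each, with weight [2 ^- L]. *)
have costE : 2 ^- L * p%:R <= Num.min 1 (N%:R / 2 ^+ L) :> R.
  rewrite le_min; apply/andP; split; rewrite mulrC ?ler_wpM2r ?ler_nat//; last by lia.
  rewrite ler_pdivrMr ?exprn_gt0// mul1r -natrX ler_nat; lia.
have : eps * (2 ^- L * p%:R) <= eps * Num.min 1 (N%:R / 2 ^+ L).
  exact: ler_wpM2l.
have := ler_wpM2l e0 leu.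
rewrite /tree_cost big_ord_recr /=; set T := \sum_(i < L) _.
lra.
Qed.

End ApproximateJensen.

(** The first [m] levels cost at most 1 each; from level [m] on the costs are
    dominated by the geometric series [1 + 1/2 + ... = 2]. *)
Lemma tree_cost_le (R : realType) (N m L : nat) :
  (N <= 2 ^ m)%N -> tree_cost R N L <= m%:R + 2.
Proof.
move=> Nm; have c_ge0 s : 0 <= Num.min 1 (N%:R / 2 ^+ s) :> R.
  by rewrite le_min ler01 divr_ge0 ?exprn_ge0.
have cost_m : tree_cost R N m <= m%:R.
  rewrite -[m in m%:R]card_ord -sum1_card natr_sum; apply: ler_sum => s _.
  by rewrite ge_min lexx.
have cost_mD j : tree_cost R N (m + j) <= m%:R + 2 - 2 / 2 ^+ j.
  elim: j => [|j IHj]; first by rewrite addn0 expr0; lra.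
  have e0 : 0 <= 2 ^- j :> R by rewrite invr_ge0 exprn_ge0.
  rewrite addnS /tree_cost big_ord_recr /=.
  have : Num.min 1 (N%:R / 2 ^+ (m + j)) <= 2 ^- j :> R.
    rewrite ge_min exprD invfM mulrA orbC ler_piMl//.
    by rewrite ler_pdivrMr ?exprn_gt0// mul1r -natrX ler_nat.
  rewrite exprS invfM mulrA divff// mul1r.
  by move: IHj; rewrite /tree_cost; lra.
have {cost_mD} := cost_mD L.
have : 0 <= 2 / 2 ^+ L :> R by rewrite divr_ge0 ?exprn_ge0.
have : tree_cost R N L <= tree_cost R N (m + L).
  by rewrite addnC /tree_cost [leRHS]big_split_ord /= lerDl sumr_ge0.
lra.
Qed.

Lemma cvg_dyadic_floor (R : realType) (t : R) : 0 <= t ->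
  (fun L => 2 ^- L * (Num.truncn (2 ^+ L * t))%:R) @ \oo --> t.
Proof.
move=> t0.
have pow0 : (fun L : nat => 2 ^- L) @ \oo --> (0 : R).
  under eq_fun do rewrite -exprVn.
  by apply: cvg_expr; rewrite ger0_norm ?invr_ge0//; lra.
apply: (@squeeze_cvgr _ _ _ _ (fun L => t - 2 ^- L) (cst t)) => //.
- near=> L; have e0 : 0 < 2 ^- L :> R by rewrite invr_gt0 exprn_gt0.
  have /andP[le1 lt1] : (Num.truncn (2 ^+ L * t))%:R <= 2 ^+ L * t
      < (Num.truncn (2 ^+ L * t)).+1%:R by rewrite truncn_itv// mulr_ge0 ?exprn_ge0.
  have tE : t = 2 ^- L * (2 ^+ L * t) by rewrite mulKf// expf_neq0.
  apply/andP; split; last by rewrite {2}tE ler_wpM2l// ltW.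
  rewrite lerBlDr -{2}[2 ^- L]mulr1 -mulrDr natr1 {1}tE.
  by rewrite ler_wpM2l ?ltW.
- rewrite -[X in _ --> X]subr0; apply: cvgB => //; exact: cvg_cst.
- exact: cvg_cst.
Unshelve. all: by end_near.
Qed.

Section ConvexCombinations.
Context {R : realType} {V : normedModType R} (K : set V) (eps : R) (g : V -> R).
Context (closedK : closed K) (contg : {within K, continuous g}).
Context (eps0 : 0 <= eps) (gK : midconvex_upto R V K eps g).

(** The weights are rounded down to multiples of [2 ^- L].  The missing mass is
    at most [N * 2 ^- L]; it is carried by at most [N] additional copies of one of
    the points, which play the part of the nodes already formed in
    [tree_jensen].  All of this converges as [L] grows. *)
Lemma jensen_upto (N m : nat) (x : 'I_N -> V) (t : 'I_N -> R) :
  (N <= 2 ^ m)%N -> (forall i, K (x i)) -> (forall i, 0 <= t i) ->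
  \sum_i t i = 1 ->
  K (\sum_i t i *: x i) /\
  g (\sum_i t i *: x i) <= \sum_i t i * g (x i) + eps * (m%:R + 2).
Proof.
case: N x t => [|N] x t Nm Kx t0 t1.
  by move: t1; rewrite big_ord0 => /esym/eqP; rewrite oner_eq0.
pose a L i := Num.truncn (2 ^+ L * t i).
have aP L i : (a L i)%:R <= 2 ^+ L * t i < (a L i).+1%:R.
  by apply: truncn_itv; rewrite mulr_ge0 ?exprn_ge0.
pose r L := (2 ^ L - \sum_i a L i)%N.
have le_a L : (\sum_i a L i <= 2 ^ L)%N.
  rewrite -(ler_nat R) natrX -[leRHS]mulr1 -[X in _ <= _ * X]t1 mulr_sumr
    natr_sum.
  apply: ler_sum => i _.
  by have /andP[] := aP L i.
have rE L : (r L)%:R = 2 ^+ L - \sum_i (a L i)%:R :> R.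
  by rewrite natrB// natrX natr_sum.
have lt_r L : (r L <= N.+1)%N.
  rewrite -(ler_nat R) rE -[2 ^+ L]mulr1 -[X in _ * X]t1 mulr_sumr -sumrB.
  have -> : N.+1%:R = \sum_(i < N.+1) 1 :> R by rewrite sumr_const card_ord.
  apply: ler_sum => i _; rewrite lerBlDl natr1.
  by have /andP[_ /ltW] := aP L i.
pose p L := \sum_i (2 ^- L * (a L i)%:R) *: x i + (2 ^- L * (r L)%:R) *: x ord0.
pose q L := \sum_i (2 ^- L * (a L i)%:R) * g (x i) + (2 ^- L * (r L)%:R) * g (x ord0).
have pq L : K (p L) /\ g (p L) <= q L + eps * (m%:R + 2).
  have := tree_jensen K eps g gK N.+1 x eps0 Kx L (a L) (nseq (r L) (x ord0)).
  rewrite size_nseq => /(_ _ (lt_r L)); case.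
  - by move=> y; rewrite mem_nseq => /andP[_ /eqP->].
  - by rewrite subnK.
  rewrite !big_nseq -!Monoid.iteropE /= => Kp gp.
  have pE : 2 ^- L *: (x ord0 *+ r L + \sum_i x i *+ a L i) = p L.
    rewrite /p scalerDr addrC scaler_sumr -[x ord0 *+ _]scaler_nat scalerA; congr (_ + _).
    by apply: eq_bigr => i _; rewrite -[x i *+ _]scaler_nat scalerA.
  have qE : 2 ^- L * (g (x ord0) *+ r L + \sum_i g (x i) *+ a L i) = q L.
    rewrite /q mulrDr addrC mulr_sumr -[_ *+ r L]mulr_natl mulrA; congr (_ + _).
    by apply: eq_bigr => i _; rewrite -[_ *+ a L i]mulr_natl mulrA.
  move: Kp gp; rewrite pE qE => Kp gp; split=> //; apply: (le_trans gp).
  by rewrite lerD2l ler_wpM2l// tree_cost_le.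
have cvga i : (fun L => 2 ^- L * (a L i)%:R) @ \oo --> t i.
  exact: cvg_dyadic_floor.
have cvgr : (fun L => 2 ^- L * (r L)%:R) @ \oo --> (0 : R).
  have -> : (fun L => 2 ^- L * (r L)%:R) = fun L => 1 - \sum_i 2 ^- L * (a L i)%:R :> R.
    apply/funext => L; rewrite rE mulrBr mulVf ?expf_neq0//; congr (_ - _).
    by rewrite mulr_sumr.
  rewrite -[X in _ --> X](subrr (\sum_i t i)) {1}t1.
  apply: cvgB; first exact: cvg_cst.
  by apply: cvg_big => [|i _]; [exact: add_continuous | exact: cvga].
have cvgp : p @ \oo --> \sum_i t i *: x i.
  rewrite -[X in _ --> X]addr0 -[X in _ + X](scale0r (x ord0)).
  apply: cvgD; last exact: cvgZr_tmp.
  apply: cvg_big => [|i _]; first exact: add_continuous.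
  exact: cvgZr_tmp.
have cvgq : q @ \oo --> \sum_i t i * g (x i).
  rewrite -[X in _ --> X]addr0 -[X in _ + X](mul0r (g (x ord0))).
  apply: cvgD; last by apply: cvgM => //; exact: cvg_cst.
  apply: cvg_big => [|i _]; first exact: add_continuous.
  by apply: cvgM => //; exact: cvg_cst.
have Kl : K (\sum_i t i *: x i).
  apply: (closed_cvg K closedK _ _ cvgp).
  by apply: nearW => L; have [] := pq L.
split=> //.
have cvggp : (g \o p) @ \oo --> g (\sum_i t i *: x i).
  have gl := (subspace_continuousP _ _).1 contg _ Kl.
  apply: cvg_trans gl => W gW.
  have /cvgp := gW; rewrite /nbhs /= => pW.
  near=> L; have : K (p L) -> W (g (p L)) by near: L.
  by apply; have [] := pq L.
apply: (ler_cvg_to cvggp (cvgD cvgq (cvg_cst (eps * (m%:R + 2))))).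
by apply: nearW => L; have [] := pq L.
Unshelve. all: by end_near.
Qed.
End ConvexCombinations.

(** * Caratheodory's theorem and the Jensen gap *)

(** The matrix with rows [(1, x i)] has more rows than columns, hence a nonzero
    left kernel. *)
Lemma affine_dependence (R : fieldType) (n N : nat) (x : 'I_N -> 'rV[R]_n) :
  (n.+1 < N)%N ->
  exists u : 'I_N -> R, [/\ exists i, u i != 0, \sum_i u i = 0 &
    \sum_i u i *: x i = 0].
Proof.
move=> nN; pose M : 'M[R]_(N, 1 + n) := row_mx (const_mx 1) (\matrix_i x i).
have kM : kermx M != 0.
  by rewrite -mxrank_eq0 mxrank_ker -lt0n subn_gt0 (leq_ltn_trans (rank_leq_col _)).
have /rowV0Pn[u /sub_kermxP uM u0] := kM.
move/eqP: uM; rewrite mul_mx_row -[X in _ == X]row_mx0.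
move=> /eqP /eq_row_mx[u1 ux]; exists (u 0); split.
- apply/existsP; apply: contraNT u0; rewrite negb_exists => /forallP u0.
  by apply/eqP/rowP => i; rewrite mxE; apply/eqP; move: (u0 i); rewrite negbK.
- have /rowP/(_ 0) := u1; rewrite !mxE => {2}<-.
  by apply: eq_bigr => i _; rewrite !mxE mulr1.
- rewrite -[RHS]ux mulmx_sum_row; apply: eq_bigr => i _; by rewrite rowK.
Qed.

(** Moving the weights along an affine dependence until one of them vanishes; the
    orientation of the dependence is chosen so that the linear functional given
    by [phi] does not decrease. *)
Lemma caratheodory_step (R : realFieldType) (n N : nat) (x : 'I_N -> 'rV[R]_n)
    (phi t : 'I_N -> R) : (n.+1 < N)%N -> (forall i, 0 <= t i) ->
  exists (j : 'I_N) (t' : 'I_N -> R), [/\ t' j = 0, forall i, 0 <= t' i,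
    \sum_i t' i = \sum_i t i, \sum_i t' i *: x i = \sum_i t i *: x i &
    \sum_i t i * phi i <= \sum_i t' i * phi i].
Proof.
move=> nN t0; have [u [unz u1 ux uphi]] : exists u : 'I_N -> R,
    [/\ exists i, u i != 0, \sum_i u i = 0, \sum_i u i *: x i = 0 &
        0 <= \sum_i u i * phi i].
  have [u [[i ui] u1 ux]] := affine_dependence R n N x nN.
  have [h|h] := leP 0 (\sum_i u i * phi i).
    by exists u; split=> //; exists i.
  exists (fun i => - u i); split.
  - by exists i; rewrite oppr_eq0.
  - by rewrite sumrN u1 oppr0.
  - by under eq_bigr do rewrite scaleNr; rewrite sumrN ux oppr0.
  - by under eq_bigr do rewrite mulNr; rewrite sumrN oppr_ge0 ltW.
have [i0 i0P] : exists i, u i < 0.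
  apply/existsP; have [//|] := boolP [exists i, u i < 0].
  rewrite negb_exists => /forallP uge; have [i /eqP[]] := unz.
  apply: (psumr_eq0P _ u1) => // k _; by rewrite leNgt uge.
have [j uj jmin] := @arg_minP _ _ _ i0 (fun i => u i < 0) (fun i => t i / - u i) i0P.
(* The largest step that keeps all the weights nonnegative. *)
pose s := t j / - u j.
have s0 : 0 <= s by rewrite divr_ge0// oppr_ge0 ltW.
exists j, (fun i => t i + s * u i); split.
- by rewrite /s invrN mulrN mulNr divfK ?subrr// lt_eqF.
- move=> i; have [ui|ui] := ltP (u i) 0; last by rewrite addr_ge0// mulr_ge0.
  have := jmin i ui; rewrite -/s ler_pdivlMr ?oppr_gt0//; lra.
- by rewrite big_split /= -mulr_sumr u1 mulr0 addr0.
- under eq_bigr do rewrite scalerDl -scalerA.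
  by rewrite big_split /= -scaler_sumr ux scaler0 addr0.
- under [leRHS]eq_bigr do rewrite mulrDl -mulrA.
  by rewrite big_split /= -mulr_sumr lerDl mulr_ge0.
Qed.

(** Beyond the usual statement, the mean of [phi] is controlled, which reduces the
    Jensen gap to combinations of [n + 1] points. *)
Lemma caratheodory (R : realFieldType) (n N : nat) (x : 'I_N -> 'rV[R]_n)
    (phi t : 'I_N -> R) : (forall i, 0 <= t i) ->
  exists N' (sigma : 'I_N' -> 'I_N) (t' : 'I_N' -> R),
   [/\ (N' <= n.+1)%N, forall i, 0 <= t' i, \sum_i t' i = \sum_i t i,
    \sum_i t' i *: x (sigma i) = \sum_i t i *: x i &
    \sum_i t i * phi i <= \sum_i t' i * phi (sigma i)].
Proof.
elim: N x phi t => [|N IHN] x phi t t0.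
  by exists 0%N, id, t; split.
have [Nn|nN] := leqP N.+1 n.+1; first by exists N.+1, id, t; split.
have [j [u [uj u0 uE ux uphi]]] := caratheodory_step R n N.+1 x phi t nN t0.
have [N' [sigma [t' [N'n t'0 t'E t'x t'phi]]]] := IHN (x \o lift j) (phi \o lift j)
  (u \o lift j) (fun i => u0 _).
exists N', (lift j \o sigma), t'; split=> //.
- by rewrite t'E -uE [RHS](bigD1_ord j)//= uj add0r.
- by rewrite t'x -ux [RHS](bigD1_ord j)//= uj scale0r add0r.
- by apply: (le_trans uphi); rewrite (bigD1_ord j)//= uj mul0r add0r.
Qed.

Section WeightedPoints.
Context {R : realType} {n : nat} (K : set 'rV[R]_n) (f : 'rV[R]_n -> R).
Context (closedK : closed K) (contf : {within K, continuous f}).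
Context (f_convex : midconvex_upto R _ K 0 f).
Context (Nf_convex : midconvex_upto R _ K 2^-1 (fun x => - f x)).

Definition weighted_in (s : seq (R * 'rV[R]_n)) : Prop :=
  {in s, forall p, 0 <= p.1 /\ K p.2}.

(** Weights of arbitrary positive total mass [S] are allowed because the separation
    argument below works with a convex cone of such weighted lists.  The lower
    bound is Jensen's inequality for [f]; the upper bound is the approximate one
    for [- f], after reduction to [n + 1] points. *)
Lemma jensen_gap (m : nat) (s : seq (R * 'rV[R]_n)) :
  (n < 2 ^ m)%N -> weighted_in s ->
  let S := \sum_(p <- s) p.1 in
  let c := S^-1 *: \sum_(p <- s) p.1 *: p.2 in 0 < S ->
  S * f c <= \sum_(p <- s) p.1 * f p.2 <= S * (f c + 2^-1 * (m%:R + 2)).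
Proof.
move=> nm ws S c S0.
pose t i := (tnth (in_tuple s) i).1 / S; pose x i := (tnth (in_tuple s) i).2.
have [t0 Kx] : (forall i, 0 <= t i) /\ (forall i, K (x i)).
  split=> i; have [] := ws _ (mem_tnth i (in_tuple s)) => // *.
  exact: divr_ge0 (ltW S0).
have t1 : \sum_i t i = 1.
  by rewrite -mulr_suml -(big_tnth _ _ _ predT fst) divff// gt_eqF.
have cE : c = \sum_i t i *: x i.
  rewrite /c big_tnth scaler_sumr; apply: eq_bigr => i _.
  by rewrite scalerA mulrC.
have fE : \sum_(p <- s) p.1 * f p.2 = S * \sum_i t i * f (x i).
  rewrite big_tnth mulr_sumr; apply: eq_bigr => i _.
  by rewrite /t mulrA mulrCA divff ?mulr1// gt_eqF.
rewrite fE !ler_pM2l//; apply/andP; split.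
  have := jensen_upto K 0 f closedK contf (lexx 0) f_convex _ _ x t
    (ltnW (ltn_expl _ (ltnSn 1))) Kx t0 t1.
  by rewrite cE mul0r addr0 => -[].
have [N [sigma [u [Nn u0 u1 ux uf]]]] := caratheodory R n _ x (f \o x) t t0.
have contNf : {within K, continuous (fun x => - f x)}.
  by move=> y; apply: continuousN; exact: contf.
have half0 : 0 <= 2^-1 :> R by rewrite invr_ge0.
have := jensen_upto K 2^-1 (fun x => - f x) closedK contNf half0 Nf_convex N m
  (x \o sigma) u (leq_trans Nn nm) (fun i => Kx _) u0 ltac:(by rewrite u1).
rewrite /= ux -cE => -[_].
under eq_bigr do rewrite mulrN.
rewrite sumrN; move: uf => /=; lra.
Qed.
End WeightedPoints.

(** * Affine approximation of functions with a small Jensen gap *)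

Definition sublinear (R : realType) (V : lmodType R) (q : V -> R) : Prop :=
  (forall u v, q (u + v) <= q u + q v) /\
  (forall a v, 0 < a -> q (a *: v) <= a * q v).

Section HahnBanach.
Context {R : realType} {V : lmodType R}.
Implicit Types q : V -> R.

Lemma sublinear0 q : sublinear R V q -> q 0 = 0.
Proof.
move=> [_ qZ]; have := qZ 2 0 ltac:(lra); have := qZ 2^-1 0 ltac:(lra).
by rewrite !scaler0; lra.
Qed.

(** The function [q' v = inf_(t >= 0) (q (v + t e) - t q e)] is again sublinear, and
    it is linear on the line spanned by [e]. *)
Lemma sublinear_straighten q (e : V) : sublinear R V q ->
  exists q', [/\ sublinear R V q', forall v, q' v <= q v & q' e + q' (- e) <= 0].
Proof.
move=> qs; have q0 := sublinear0 q qs; have [qD qZ] := qs.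
pose E v := [set q (v + t *: e) - t * q e | t in [set t : R | 0 <= t]].
have E_in v t : 0 <= t -> E v (q (v + t *: e) - t * q e) by exists t.
have E0 v : E v !=set0 by exists (q (v + 0 *: e) - 0 * q e); exact: E_in.
have Elb v : has_lbound (E v).
  exists (- q (- v)) => _ [t t0 <-].
  have : t * q e <= q (v + t *: e) + q (- v).
    have : q (t *: e) <= q (v + t *: e) + q (- v).
      by apply: le_trans (qD _ _); rewrite addrC addrA addNr add0r.
    apply: le_trans; have [->|tn0] := eqVneq t 0; first by rewrite scale0r q0 mul0r.
    have tp : 0 < t by rewrite lt_def tn0.
    have := qZ t^-1 (t *: e); rewrite invr_gt0 scalerA mulVf// scale1r => /(_ tp).
    by rewrite mulrC ler_pdivlMr// mulrC.
  lra.
pose q' v := inf (E v).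
have q'le v t : 0 <= t -> q' v <= q (v + t *: e) - t * q e.
  by move=> t0; apply: ge_inf => //; exact: E_in.
have q'ge v z : (forall t, 0 <= t -> z <= q (v + t *: e) - t * q e) -> z <= q' v.
  by move=> zle; apply: lb_le_inf => // _ [t t0 <-]; exact: zle.
exists q'; split; first split.
- move=> u v; rewrite -lerBlDl; apply: (q'ge _ _) => s s0.
  rewrite lerBlDl -lerBlDr; apply: (q'ge _ _) => t t0; rewrite lerBlDr.
  apply: (le_trans (q'le _ (t + s) (addr_ge0 t0 s0))).
  have := qD (u + t *: e) (v + s *: e); rewrite addrACA -scalerDl.
  lra.
- move=> a v a0; rewrite -ler_pdivrMl//; apply: (q'ge _ _) => t t0.
  rewrite ler_pdivrMl//.
  apply: (le_trans (q'le _ (a * t) (mulr_ge0 (ltW a0) t0))).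
  rewrite -scalerA -scalerDr mulrBr mulrA lerD2r; exact: qZ.
- by move=> v; have := q'le v 0 (lexx _); rewrite scale0r addr0 mul0r subr0.
- have := q'le e 0 (lexx _); have := q'le (- e) 1 ler01.
  by rewrite scale1r scale0r addNr addr0 q0; lra.
Qed.

(** Straightening along one vector preserves the straightness already obtained,
    since [q' e + q' (- e)] can only decrease, while it is never negative. *)
Lemma sublinear_minorant q (es : seq V) : sublinear R V q ->
  exists q', [/\ sublinear R V q', forall v, q' v <= q v &
    {in es, forall e, q' e + q' (- e) <= 0}].
Proof.
elim: es q => [|e es IHes] q qs; first by exists q; split.
have [q1 [q1s q1q q1e]] := sublinear_straighten q e qs.
have [q2 [q2s q2q1 q2e]] := IHes q1 q1s.
exists q2; split=> //; first by move=> v; exact: le_trans (q2q1 _) (q1q _).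
move=> d; rewrite inE => /orP[/eqP->|/q2e//].
by apply: le_trans q1e; exact: lerD.
Qed.

Lemma hahn_banach_coord q k (e : 'I_k -> V) : sublinear R V q ->
  exists l : 'I_k -> R, forall c : 'I_k -> R,
    \sum_i c i * l i <= q (\sum_i c i *: e i).
Proof.
move=> qs; have [q' [q's q'q q'e]] := sublinear_minorant q (codom e) qs.
have [qD qZ] := q's; have q0 := sublinear0 q' q's.
exists (q' \o e) => c; apply: le_trans (q'q _).
have term a i : q' (- (a *: e i)) <= - (a * q' (e i)).
  have ei := q'e _ (codom_f e i).
  have [a0|a0|->] := ltgtP a 0; last by rewrite scale0r oppr0 q0 mul0r oppr0.
    by rewrite -scaleNr -mulNr; apply: qZ; rewrite oppr_gt0.
  rewrite -scalerN; apply: (le_trans (qZ _ _ a0)).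
  by rewrite -mulrN ler_wpM2l ?(ltW a0)//; lra.
have : q' (- \sum_i c i *: e i) <= - \sum_i c i * q' (e i).
  rewrite -!sumrN; elim/big_ind2 : _ => [||i _]; [by rewrite q0| |exact: term].
  by move=> u a v b ua vb; apply: (le_trans (qD _ _)); exact: lerD.
have := qD (\sum_i c i *: e i) (- \sum_i c i *: e i); rewrite subrr q0 /=.
lra.
Qed.
End HahnBanach.

(** A convex cone [Q] in the product of a space with the real line, which projects
    onto the space and meets the vertical axis only in nonnegative numbers, lies
    above a hyperplane: the lower boundary of [Q] is a sublinear function. *)
Lemma cone_separation (R : realType) (k : nat) (Q : 'rV[R]_k -> R -> Prop) :
  (forall u v a b, Q u a -> Q v b -> Q (u + v) (a + b)) ->
  (forall c u a, 0 < c -> Q u a -> Q (c *: u) (c * a)) ->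
  (forall a, Q 0 a -> 0 <= a) ->
  (forall u, exists a, Q u a) ->
  exists l : 'I_k -> R, forall u a, Q u a -> \sum_i u 0 i * l i <= a.
Proof.
move=> QD QZ Q0 Qex; pose q u := inf (Q u).
have Qlb u : has_lbound (Q u).
  have [b Qb] := Qex (- u); exists (- b) => a Qa.
  by rewrite -subr_ge0 opprK; apply: Q0; rewrite -(subrr u); exact: QD.
have qle u a : Q u a -> q u <= a by move=> Qa; apply: ge_inf.
have qge u z : (forall a, Q u a -> z <= a) -> z <= q u.
  by move=> h; apply: lb_le_inf => //; exact: Qex.
have qs : sublinear R _ q.
  split=> [u v|c u c0].
    rewrite -lerBlDl; apply: (qge _ _) => b Qb; rewrite lerBlDl -lerBlDr.
    by apply: (qge _ _) => a Qa; rewrite lerBlDr; apply/qle/QD.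
  rewrite -ler_pdivrMl//; apply: (qge _ _) => a Qa; rewrite ler_pdivrMl//.
  exact/qle/QZ.
have [l lq] := hahn_banach_coord q k (delta_mx 0) qs.
exists l => u a Qa; apply: le_trans (qle _ _ Qa).
by rewrite [in leRHS](row_sum_delta u).
Qed.

Section BestAffineApproximation.
Context {R : realType} {n : nat} (K : set 'rV[R]_n) (f : 'rV[R]_n -> R) (c : R).

Definition lift_point (x : 'rV[R]_n) : 'rV[R]_(1 + n) := row_mx (const_mx 1) x.

Definition moment (s : seq (R * 'rV[R]_n)) : 'rV[R]_(1 + n) :=
  \sum_(p <- s) p.1 *: lift_point p.2.

(** If [P] is affine with [`|f - P| <= c] then integrating [f + c >= P] against [s]
    and [c - f >= - P] against [r] shows that [signed_cost s r] is at least the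
    integral of [P] against [s - r]. *)
Definition signed_cost (s r : seq (R * 'rV[R]_n)) : R :=
  \sum_(p <- s) p.1 * (f p.2 + c) + \sum_(p <- r) p.1 * (c - f p.2).

Lemma momentE s :
  moment s = row_mx (const_mx (\sum_(p <- s) p.1)) (\sum_(p <- s) p.1 *: p.2).
Proof.
rewrite /moment; elim: s => [|p s IHs].
  by rewrite !big_nil -[LHS]row_mx0; congr row_mx; apply/matrixP => i j; rewrite !mxE.
rewrite !big_cons IHs /lift_point scale_row_mx add_row_mx; congr row_mx.
by apply/matrixP => i j; rewrite !mxE mulr1.
Qed.

Lemma interior_segment (x v : 'rV[R]_n) : interior K x ->
  exists2 s : R, 0 < s & K (x + s *: v).
Proof.
move=> Kx.
have cv : (fun s : R => x + s *: v) @ 0^'+ --> x.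
  rewrite -[X in _ --> X]addr0 -[X in _ + X](scale0r v).
  apply: cvgD; first exact: cvg_cst.
  by apply: cvgZr_tmp; apply: cvg_at_right_filter; exact: cvg_id.
have : \forall s \near (0 : R)^'+, K (x + s *: v) by exact: (cv _ Kx).
move=> near_K; near (0 : R)^'+ => s; exists s; near: s => //.
exact: nbhs_right_gt.
Unshelve. all: by end_near.
Qed.

(** A segment from an interior point in the direction of a given vector stays in
    [K] for a while; its endpoints with opposite large weights produce that
    vector. *)
Lemma moment_surj : interior K !=set0 -> forall w, exists s r,
  [/\ weighted_in K s, weighted_in K r & moment s - moment r = w].
Proof.
move=> [x Kx] w; have KxK := interior_subset Kx.
pose t := lsubmx w 0 0; pose v := rsubmx w - t *: x.
have [s s0 Ks] := interior_segment x v Kx.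
exists [:: (s^-1, x + s *: v); (Num.max t 0, x)],
       [:: (s^-1, x); (Num.max (- t) 0, x)]; split.
- move=> p; rewrite !inE => /orP[]/eqP-> /=; split=> //.
    by rewrite invr_ge0 ltW.
  by rewrite le_max lexx orbT.
- move=> p; rewrite !inE => /orP[]/eqP-> /=; split=> //.
    by rewrite invr_ge0 ltW.
  by rewrite le_max lexx orbT.
rewrite !momentE !big_cons !big_nil /= !addr0 opp_row_mx add_row_mx -[w]hsubmxK.
have tE : Num.max t 0 - Num.max (- t) 0 = t.
  by have [h|h] := leP t 0; have [h'|h'] := leP (- t) 0; lra.
congr row_mx.
  by apply/matrixP => i j; rewrite !ord1 !mxE opprD addrACA subrr add0r tE /t mxE.
rewrite scalerDr scalerA mulVf ?gt_eqF// scale1r opprD addrACA -scalerBl tE.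
by rewrite [_ *: x + v]addrC addrK subrK.
Qed.

(** The pairs of a signed moment and its cost form a convex cone.  A hyperplane
    below this cone is an affine function, and the two measures with the single
    atom [x], one positive and one negative, give the two inequalities in
    [`|f x - P x| <= c]. *)
Lemma affine_approx_of_gap : interior K !=set0 ->
  (forall s r, weighted_in K s -> weighted_in K r -> moment s = moment r ->
    0 <= signed_cost s r) ->
  exists a (b : 'I_n -> R), forall x, K x ->
    `|f x - (a + \sum_i b i * x 0 i)| <= c.
Proof.
move=> K0 gap.
pose Q w z := exists s r, [/\ weighted_in K s, weighted_in K r,
  moment s - moment r = w & signed_cost s r = z].
have weighted_cat s s' : weighted_in K s -> weighted_in K s' ->
    weighted_in K (s ++ s').
  by move=> ws ws' p; rewrite mem_cat => /orP[/ws|/ws'].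
have [|||w|l lQ] := cone_separation R (1 + n) Q.
- move=> _ _ _ _ [s [r [ws wr <- <-]]] [s' [r' [ws' wr' <- <-]]].
  exists (s ++ s'), (r ++ r'); split; [exact: weighted_cat..| |].
    by rewrite /moment !big_cat /= opprD addrACA.
  by rewrite /signed_cost !big_cat /= addrACA.
- move=> d _ _ d0 [s [r [ws wr <- <-]]].
  pose scl (s : seq (R * 'rV[R]_n)) := [seq (d * p.1, p.2) | p <- s].
  have wscl s' : weighted_in K s' -> weighted_in K (scl s').
    move=> ws' _ /mapP[p /ws'[p0 Kp] ->] /=; split=> //; exact: mulr_ge0 (ltW d0) p0.
  have mscl s' : moment (scl s') = d *: moment s'.
    rewrite /moment big_map scaler_sumr; apply: eq_bigr => p _.
    by rewrite scalerA.
  exists (scl s), (scl r); split; [exact: wscl..| |].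
    by rewrite !mscl scalerBr.
  rewrite /signed_cost !big_map mulrDr !mulr_sumr /=.
  by congr (_ + _); apply: eq_bigr => p _; rewrite mulrA.
- move=> _ [s [r [ws wr /eqP + <-]]]; rewrite subr_eq0 => /eqP.
  exact: gap.
- have [s [r [ws wr sr]]] := moment_surj K0 w.
  by exists (signed_cost s r), s, r; split.
exists (l (lshift n ord0)), (fun i => l (rshift 1 i)) => x Kx.
set P := (X in f x - X).
have PE (d : R) : \sum_i (d *: lift_point x) 0 i * l i = d * P.
  rewrite big_split_ord /= big_ord1 mxE [lift_point x 0 _]row_mxEl mxE mulr1 /P.
  rewrite mulrDr mulr_sumr.
  congr (_ + _); apply: eq_bigr => i _.
  by rewrite mxE [lift_point x 0 _]row_mxEr -mulrA [x 0 i * _]mulrC.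
have w1 : weighted_in K [:: (1, x)] by move=> p /[!inE]/eqP-> /=.
have w0 : weighted_in K [::] by [].
have up := lQ (1 *: lift_point x) (f x + c).
have lo := lQ (-1 *: lift_point x) (c - f x).
rewrite ler_norml; apply/andP; split.
- rewrite PE in up; rewrite -subr_ge0; suff : 1 * P <= f x + c by lra.
  apply: up; exists [:: (1, x)], [::]; split=> //.
    by rewrite /moment big_seq1 big_nil subr0.
  by rewrite /signed_cost big_seq1 big_nil addr0 mul1r.
- rewrite PE in lo; suff : -1 * P <= c - f x by lra.
  apply: lo; exists [::], [:: (1, x)]; split=> //.
    by rewrite /moment big_seq1 big_nil sub0r scale1r scaleN1r.
  by rewrite /signed_cost big_seq1 big_nil add0r mul1r.
Qed.

End BestAffineApproximation.

(** * Polynomials of degree at most one and the upper bound *)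

Section AffinePolynomials.
Import -(notations) mpoly.
Context {R : realType} {n : nat}.

Lemma affine_mpoly (a : R) (b : 'I_n -> R) :
  exists2 P : mpoly n R, poly_deg_le 1 P &
    forall x, mpoly_fun P x = a + \sum_i b i * x 0 i.
Proof.
exists (mpolyC n a + \sum_i b i *: mpolyX R (mnm1 i)).
  rewrite /poly_deg_le /=; apply: (leq_trans (msizeD_le _ _)); rewrite geq_max.
  rewrite msizeC (leq_trans (leq_b1 _))//=; apply: (leq_trans (msize_sum _ _ _)).
  apply/bigmax_leqP => i _; apply: (leq_trans (msizeZ_le _ _)).
  by rewrite msizeX mdeg1.
move=> x; rewrite /mpoly_fun mevalD mevalC; congr (_ + _).
rewrite raddf_sum; apply: eq_bigr => i _.
by rewrite /= mevalZ mevalXU.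
Qed.

Lemma mpoly_fun_affine (P : mpoly n R) : poly_deg_le 1 P ->
  exists (a : R) (b : 'I_n -> R), forall x, mpoly_fun P x = a + \sum_i b i * x 0 i.
Proof.
move=> P1.
pose mono (m : multinom n) (c : R) :=
  if mdeg m == 0%N then (c, fun=> 0) else (0, fun i : 'I_n => c * (m i)%:R).
exists (\sum_(m <- msupp P) (mono m (mcoeff m P)).1),
  (fun i => \sum_(m <- msupp P) (mono m (mcoeff m P)).2 i) => x.
under [X in _ + X]eq_bigr do rewrite mulr_suml.
rewrite exchange_big -big_split /mpoly_fun mevalE /=.
rewrite big_seq [RHS]big_seq; apply: eq_bigr => m mP.
have : (mdeg m <= 1)%N.
  by have := msize_mdeg_lt mP; move: P1; rewrite /poly_deg_le /=; lia.
rewrite leq_eqVlt ltnS leqn0 orbC /mono.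
case: eqP => [m0 _|_] /=.
  have -> : m = mnm0 by apply/eqP; rewrite -mdeg_eq0 m0.
  rewrite big1 ?mulr1; last by move=> i _; rewrite mnm0E expr0.
  by rewrite [X in _ + X]big1 ?addr0// => i _; rewrite mul0r.
move=> /mdeg1P[i /eqP->].
rewrite (bigD1 i)//= [in LHS]big1; last first.
  by move=> j ji; rewrite mnm1E eq_sym (negbTE ji) expr0.
rewrite mnm1E eqxx expr1 mulr1 add0r (bigD1 i)//= mnm1E eqxx mulr1 big1 ?addr0//.
by move=> j ji; rewrite mnm1E eq_sym (negbTE ji) mulr0 mul0r.
Qed.

End AffinePolynomials.

Lemma convex_set_midpoint (R : realType) n (K : set 'rV[R]_n) :
  convex_set K -> forall x y, K x -> K y -> K (2^-1 *: (x + y)).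
Proof.
move=> cK x y Kx Ky.
have h0 : 0 <= 2^-1 :> R by rewrite invr_ge0.
have h1 : 2^-1 <= 1 :> R by lra.
have := cK x y (Itv01 h0 h1); rewrite !inE => /(_ Kx Ky).
rewrite /conv /= /unstable.onem scalerDr.
by have -> : 1 - 2^-1 = 2^-1 :> R by lra.
Qed.

Lemma sum_weighted_eq0 (R : realType) n (K : set 'rV[R]_n) (h : 'rV[R]_n -> R) s :
  weighted_in K s -> \sum_(p <- s) p.1 = 0 -> \sum_(p <- s) p.1 * h p.2 = 0.
Proof.
move=> ws /eqP; rewrite big_seq psumr_eq0; last by move=> p /ws[].
move=> /allP s0; rewrite big_seq big1// => p ps.
by have := s0 p ps; rewrite ps => /eqP ->; rewrite mul0r.
Qed.

Lemma second_difference_bounds (R : realType) n (K : set 'rV[R]_n) f :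
  (modulus_smoothness 2 K f <= 1)%E -> forall x y, K x -> K y ->
  K (2^-1 *: (x + y)) -> `|f x - 2 * f (2^-1 *: (x + y)) + f y| <= 1.
Proof.
move=> fm x y Kx Ky Km.
pose h := 2^-1 *: (y - x).
have xh : x + h = 2^-1 *: (x + y).
  rewrite /h -[x in x + _]scale1r scalerBr scalerDr.
  rewrite addrCA -scalerBl addrC; congr (_ *: _ + _); lra.
have x2h : x + h *+ 2 = y.
  by rewrite /h -scaler_nat scalerA divff// scale1r addrC subrK.
rewrite -lee_fin; apply: le_trans fm; apply: ereal_sup_ubound.
exists (x, h) => /=.
  move=> [|[|[|]]] // _; rewrite ?mulr0n ?addr0 ?mulr1n ?xh//.
  by rewrite x2h.
congr (`|_|%:E); rewrite /finite_diff !big_ord_recl big_ord0 /=.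
rewrite /bump /= !addn0 /= mulr0n addr0 mulr1n xh.
have -> : (1 + 1)%N = 2%N by [].
rewrite x2h bin1 expr0 expr1 sqrrN expr1n; lra.
Qed.

(** If two weighted lists have the same moment, Jensen's inequality for one and the
    gap estimate for the other are taken at the same barycenter, so that the cost
    in [affine_approx_of_gap] is nonnegative when [2 * c] is the gap. *)
Lemma global_convex_whitney_le (R : realType) (n m : nat) : (n < 2 ^ m)%N ->
  (global_convex_whitney R 2 n <= (4^-1 * (m%:R + 2))%:E)%E.
Proof.
move=> nm; apply: ge_ereal_sup => _ [K [cK vK iK] <-].
apply: ge_ereal_sup => _ [f [[contf convf] fm] <-].
have closedK : closed K by apply: compact_closed cK; exact: norm_hausdorff.
have mid := convex_set_midpoint R n K vK.
have f_mid : midconvex_upto R _ K 0 f.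
  move=> x y Kx Ky; split; first exact: mid.
  by have := convf x y Kx Ky; lra.
have Nf_mid : midconvex_upto R _ K 2^-1 (fun x => - f x).
  move=> x y Kx Ky; split; first exact: mid.
  have := second_difference_bounds R n K f fm x y Kx Ky (mid x y Kx Ky).
  by rewrite ler_norml => /andP[]; lra.
have gap := jensen_gap K f closedK contf f_mid Nf_mid m _ nm.
set c := 4^-1 * _.
have [|a [b fab]] := affine_approx_of_gap K f c iK.
  move=> s r ws wr; rewrite !momentE => /eq_row_mx[/matrixP/(_ 0 0) + rm].
  rewrite !mxE => sr.
  have costE : signed_cost f c s r = \sum_(p <- s) p.1 * f p.2
      - \sum_(p <- r) p.1 * f p.2 + 2 * c * \sum_(p <- s) p.1.
    rewrite /signed_cost; under eq_bigr do rewrite mulrDr.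
    under [X in _ + X]eq_bigr do rewrite mulrBr.
    by rewrite sumrB big_split /= -!mulr_suml -sr; ring.
  rewrite costE; have S0 : 0 <= \sum_(p <- s) p.1.
    by rewrite big_seq sumr_ge0// => p /ws[].
  (* Without mass there is no barycenter, but then all the weights vanish. *)
  have := S0; rewrite le_eqVlt => /orP[/eqP S_eq0|S_gt0].
    rewrite (sum_weighted_eq0 R n K f s)// (sum_weighted_eq0 R n K f r)//; last 1 first.
      by rewrite -sr.
    by rewrite -S_eq0 mulr0 subrr addr0.
  have /andP[+ _] := gap s ws S_gt0.
  have /andP[_] := gap r wr ltac:(by rewrite -sr).
  by rewrite -rm -sr /c; lra.
have [P P1 PE] := affine_mpoly a b.
apply: (@le_trans _ _ (sup_norm K (fun x => f x - mpoly_fun P x))).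
  by apply: ereal_inf_lbound; exists P.
apply: ge_ereal_sup => _ [x Kx <-]; rewrite lee_fin PE.
exact: fab.
Qed.

(** * The negative entropy on the simplex and the lower bound *)

Section XLogX.
Context {R : realType}.
Implicit Types a b t : R.

Definition xlnx (t : R) : R := t * ln t.

Lemma xlnx0 : xlnx 0 = 0. Proof. exact: mul0r. Qed.

Lemma xlnx1 : xlnx 1 = 0. Proof. by rewrite /xlnx ln1 mulr0. Qed.

(** This controls [xlnx] near [0]: it follows from [ln y <= y] at
    [y = 1 / sqrt t]. *)
Lemma xlnx_sqrt_bound t : t <= 1 -> - (2 * Num.sqrt t) <= xlnx t <= 2 * Num.sqrt t.
Proof.
move=> t1; have [t0|t0] := leP t 0.
  by rewrite /xlnx ln0// mulr0 ler0_sqrtr// mulr0 oppr0 lexx.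
have s0 : 0 < Num.sqrt t by rewrite sqrtr_gt0.
have lt : ln t <= 0 by rewrite ln_le0.
have tE : t = Num.sqrt t ^+ 2 by rewrite sqr_sqrtr// ltW.
have xE : xlnx t = - (2 * (Num.sqrt t * (Num.sqrt t * ln (Num.sqrt t)^-1))).
  by rewrite /xlnx lnV ?posrE// {1 2}tE lnXn// mulr2n; ring.
have : Num.sqrt t * ln (Num.sqrt t)^-1 <= 1.
  rewrite mulrC -ler_pdivlMr// div1r ltW// ln_sublinear// invr_gt0//.
rewrite -(ler_pM2l s0) mulr1 => h.
apply/andP; split; first by rewrite xE lerN2 ler_pM2l.
apply: (@le_trans _ _ 0); last by rewrite mulr_ge0// ltW.
by rewrite /xlnx mulr_ge0_le0// ltW.
Qed.

Lemma continuous_xlnx : continuous (xlnx : R -> R).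
Proof.
move=> t; have [t0|t0] := leP t 0; last first.
  by apply: continuousM; [exact: cvg_id | exact: continuous_ln].
have xt : xlnx t = 0 by rewrite /xlnx ln0// mulr0.
rewrite /continuous_at xt.
have st : (fun s => 2 * Num.sqrt s) @ t --> (0 : R).
  rewrite -[X in _ --> X](mulr0 2); apply: cvgM; first exact: cvg_cst.
  by have := @sqrt_continuous R t; rewrite /continuous_at ler0_sqrtr.
apply: (@squeeze_cvgr _ _ _ _ (fun s => - (2 * Num.sqrt s))
                              (fun s => 2 * Num.sqrt s)) => //.
- near=> s; apply: xlnx_sqrt_bound; apply: ltW; near: s.
  exact: (@cvgr_lt _ _ _ _ id t cvg_id 1 ltac:(lra)).
- by rewrite -[X in _ --> X]oppr0; exact: cvgN.
Unshelve. all: by end_near.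
Qed.

(** The lower bound adds the tangent inequalities of [xlnx] at the midpoint.  The
    upper bound comes from [a ln a <= a ln (a + b)] and the same for [b]. *)
Lemma xlnx_second_difference a b : 0 <= a -> 0 <= b ->
  0 <= xlnx a + xlnx b - 2 * xlnx (2^-1 * (a + b)) <= (a + b) * ln 2.
Proof.
move=> a0 b0; have := addr_ge0 a0 b0; rewrite le_eqVlt => /orP[/eqP ab0|ab0].
  have -> : a = 0 by lra.
  have -> : b = 0 by lra.
  by rewrite addr0 mulr0 xlnx0 mulr0 mul0r addr0 subr0 lexx.
have m0 : 0 < 2^-1 * (a + b) by lra.
apply/andP; split.
  set m := 2^-1 * (a + b) in m0 *.
  have tangent t : 0 <= t -> t * ln m + (t - m) <= xlnx t.
    rewrite le_eqVlt => /orP[/eqP<-|t0]; first by rewrite xlnx0; lra.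
    have : ln (m / t) <= m / t - 1.
      have /le_ln1Dx : -1 < m / t - 1 by have : 0 < m / t by [exact: divr_gt0|]; lra.
      by rewrite addrCA subrr addr0.
    rewrite ln_div ?posrE// -(ler_pM2l t0) mulrBr mulrBr mulrCA divff ?gt_eqF//.
    rewrite /xlnx; lra.
  have := tangent a a0; have := tangent b b0; move=> tb ta.
  have : 2 * xlnx m = a * ln m + b * ln m by rewrite /xlnx {1}/m; lra.
  have : 2 * m = a + b by rewrite /m; lra.
  move: ta tb; clearbody m; lra.
have below t : 0 <= t -> t <= a + b -> xlnx t <= t * ln (a + b).
  rewrite le_eqVlt => /orP[/eqP<-|t0] tab; first by rewrite xlnx0 mul0r.
  by rewrite /xlnx ler_pM2l// ler_ln.
have xm : 2 * xlnx (2^-1 * (a + b)) = (a + b) * (ln (a + b) - ln 2).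
  rewrite /xlnx lnM ?posrE// lnV ?posrE//; lra.
have := below a a0 ltac:(lra); have := below b b0 ltac:(lra); rewrite xm.
lra.
Qed.
End XLogX.

Section Simplex.
Context {R : realType} (n : nat).

(** The first barycentric coordinate [1 - \sum_i x 0 i] is left implicit. *)
Definition simplex : set 'rV[R]_n :=
  [set x | (forall i, 0 <= x 0 i) /\ \sum_i x 0 i <= 1].

(** The factor makes the logarithms binary and halves the entropy, so that the
    modulus of smoothness is at most [1]. *)
Definition negentropy (x : 'rV[R]_n) : R :=
  (2 * ln 2)^-1 * (xlnx (1 - \sum_i x 0 i) + \sum_i xlnx (x 0 i)).

Lemma continuous_sum_coord (h : R -> R) : continuous h ->
  continuous (fun x : 'rV[R]_n => \sum_i h (x 0 i)).
Proof.
move=> ch; apply: continuous_big => [|i _ x]; first exact: add_continuous.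
exact: (continuous_comp (@coord_continuous _ _ _ 0 i x) (ch _)).
Qed.

Lemma continuous_negentropy : continuous negentropy.
Proof.
have csum : continuous (fun x : 'rV[R]_n => \sum_i x 0 i).
  by apply: (continuous_sum_coord id) => t; exact: cvg_id.
move=> x; have c1 : {for x, continuous (fun y : 'rV[R]_n => 1 - \sum_i y 0 i)}.
  have h := @cst_continuous 'rV[R]_n R 1 x.
  exact: continuousB h (csum x).
have c2 := continuousD (continuous_comp c1 (continuous_xlnx _))
  (continuous_sum_coord _ continuous_xlnx x).
have h := @cst_continuous 'rV[R]_n R (2 * ln 2)^-1 x.
exact: continuousM h c2.
Qed.

Lemma simplex_compact : compact simplex.
Proof.
pose cube := [set x : 'rV[R]_n | forall i, (`[0, 1]%classic : set R) (x ord0 i)].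
apply: (@subclosed_compact _ simplex cube).
- have -> : simplex =
    \bigcap_(i in setT) ((fun x : 'rV[R]_n => x 0 i) @^-1` [set t | 0 <= t])
    `&` (fun x : 'rV[R]_n => \sum_i x 0 i) @^-1` [set t | t <= 1].
    by apply/seteqP; split=> x [h1 h2]; split=> // i; [move=> _|]; exact: h1.
  apply: closedI.
    apply: closed_bigI => i _; apply: preimage_closed; last exact: closed_ge.
    by move=> y _; exact: coord_continuous.
  apply: preimage_closed; last exact: closed_le.
  by move=> y _; apply: (continuous_sum_coord id) => t; exact: cvg_id.
- apply: (@rV_compact _ _ (fun=> (`[0, 1]%classic : set R))) => i.
  exact: segment_compact.
- move=> x [x0 x1] i; rewrite /= in_itv /= x0 /=; apply: le_trans x1.
  by rewrite (bigD1 i)//= lerDl sumr_ge0.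
Qed.

Lemma simplex_convex : convex_set simplex.
Proof.
move=> x y t; rewrite !inE => -[x0 x1] [y0 y1]; rewrite /conv /= /unstable.onem.
have t0 : 0 <= t%:inum by [].
have t1 : 0 <= 1 - t%:inum by rewrite subr_ge0.
split=> [i|]; first by rewrite !mxE addr_ge0// mulr_ge0.
have -> : \sum_i (t%:inum *: x + (1 - t%:inum) *: y) 0 i =
    t%:inum * \sum_i x 0 i + (1 - t%:inum) * \sum_i y 0 i.
  by rewrite !mulr_sumr -big_split; apply: eq_bigr => i _; rewrite !mxE.
have := ler_wpM2l t0 x1; have := ler_wpM2l t1 y1; lra.
Qed.

Lemma simplex_interior : interior simplex !=set0.
Proof.
have N0 : 0 < n.+1%:R :> R by rewrite ltr0n.
pose r : R := n.+1%:R^-1 / n.+1%:R.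
have r1 : r <= n.+1%:R^-1 by rewrite ler_pdivrMr// ler_peMr ?invr_ge0 ?ler1n.
have near_centroid (y : 'rV[R]_n) :
    (forall i, `|n.+1%:R^-1 - y 0 i| < r) -> simplex y.
  move=> yr; split=> [i|].
    have := yr i; rewrite ltr_norml => /andP[_].
    by move: r1 {yr}; move: r (n.+1%:R^-1) => e v; lra.
  apply: (@le_trans _ _ (\sum_(i < n) (n.+1%:R^-1 + r))).
    apply: ler_sum => i _; have := yr i; rewrite ltr_norml => /andP[+ _].
    by move: r1 {yr}; move: r (n.+1%:R^-1) => e v; lra.
  rewrite sumr_const card_ord -[_ *+ n]mulr_natl {}/r in r1 yr *.
  have nE : n%:R = n.+1%:R - 1 :> R by rewrite -natr1; lra.
  have NV : n.+1%:R * n.+1%:R^-1 = 1 :> R by rewrite divff// gt_eqF.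
  rewrite nE; move: n.+1%:R N0 NV => N N0 NV.
  have -> : (N - 1) * (N^-1 + N^-1 / N) = 1 - N^-1 / N.
    have -> : (N - 1) * (N^-1 + N^-1 / N)
      = N * N^-1 - N^-1 + (N * N^-1) * N^-1 - N^-1 / N by ring.
    by rewrite NV; ring.
  by rewrite gerBl mulr_ge0 ?invr_ge0 ?(ltW N0).
exists (const_mx (n.+1%:R^-1)); apply/nbhs_ballP.
exists r => /=; first by rewrite divr_gt0 ?invr_gt0.
move=> y [_ yb]; apply: near_centroid => i.
by have := yb 0 i; rewrite mxE.
Qed.

(** Summing the estimate of [xlnx_second_difference] over the barycentric
    coordinates gives at most [(1 + 1) * ln 2] before normalization. *)
Lemma negentropy_second_difference x y : simplex x -> simplex y ->
  0 <= negentropy x + negentropy y - 2 * negentropy (2^-1 *: (x + y)) <= 1.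
Proof.
move=> [x0 x1] [y0 y1].
have l2 : 0 < ln (2 : R) by rewrite ln_gt0//; lra.
pose u (z : 'rV[R]_n) := 1 - \sum_i z 0 i.
have ux : 0 <= u x by rewrite subr_ge0.
have uy : 0 <= u y by rewrite subr_ge0.
have um : u (2^-1 *: (x + y)) = 2^-1 * (u x + u y).
  have -> : u (2^-1 *: (x + y)) = 1 - 2^-1 * (\sum_i x 0 i + \sum_i y 0 i).
    rewrite /u -big_split mulr_sumr; congr (_ - _).
    by apply: eq_bigr => i _; rewrite !mxE.
  rewrite /u; lra.
pose D a b : R := xlnx a + xlnx b - 2 * xlnx (2^-1 * (a + b)).
have DE : negentropy x + negentropy y - 2 * negentropy (2^-1 *: (x + y)) =
    (2 * ln 2)^-1 * (D (u x) (u y) + \sum_i D (x 0 i) (y 0 i)).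
  rewrite /negentropy -!/(u _) um /D.
  rewrite sumrB big_split -mulr_sumr /=.
  have -> : \sum_i xlnx ((2^-1 *: (x + y)) 0 i) = \sum_i xlnx (2^-1 * (x 0 i + y 0 i)).
    by apply: eq_bigr => i _; rewrite !mxE.
  ring.
have /andP[D0 D1] := xlnx_second_difference _ _ ux uy.
rewrite DE; apply/andP; split.
  rewrite mulr_ge0 ?invr_ge0 ?mulr_ge0 ?(ltW l2)// addr_ge0// sumr_ge0// => i _.
  by have /andP[] := xlnx_second_difference _ _ (x0 i) (y0 i).
rewrite ler_pdivrMl ?mulr_gt0// mulr1.
apply: (@le_trans _ _ ((u x + u y) * ln 2 + \sum_i (x 0 i + y 0 i) * ln 2)).
  apply: lerD => //; apply: ler_sum => i _.
  by have /andP[] := xlnx_second_difference _ _ (x0 i) (y0 i).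
rewrite -mulr_suml big_split /= /u; lra.
Qed.

Lemma negentropy_vertex0 : negentropy 0 = 0.
Proof.
rewrite /negentropy !big1 ?subr0 ?xlnx1 ?addr0 ?mulr0// => i _; by rewrite mxE ?xlnx0.
Qed.

Lemma negentropy_vertex i : negentropy (delta_mx 0 i) = 0.
Proof.
rewrite /negentropy (bigD1 i)//= [X in 1 - (_ + X)]big1; last first.
  by move=> j ji; rewrite mxE eqxx (negbTE ji).
rewrite mxE !eqxx addr0 subrr xlnx0 add0r big1 ?mulr0// => j _.
by rewrite mxE eqxx; case: eqP => _; rewrite ?xlnx0 ?xlnx1.
Qed.

Lemma negentropy_centroid :
  negentropy (const_mx n.+1%:R^-1) = - (2^-1 * log2 (n%:R + 1)).
Proof.
have N0 : 0 < n.+1%:R :> R by rewrite ltr0n.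
have l2 : 0 < ln (2 : R) by rewrite ln_gt0//; lra.
have sumc (h : R -> R) : \sum_(i < n) h ((const_mx n.+1%:R^-1 : 'rV[R]_n) 0 i)
    = n%:R * h n.+1%:R^-1.
  under eq_bigr do rewrite mxE.
  by rewrite sumr_const card_ord mulr_natl.
rewrite /negentropy (sumc id) (sumc xlnx).
have nE : n%:R = n.+1%:R - 1 :> R by rewrite -natr1; lra.
have -> : 1 - n%:R * n.+1%:R^-1 = n.+1%:R^-1 :> R.
  by rewrite nE mulrBl divff ?gt_eqF// mul1r subKr.
rewrite -{1}[xlnx _]mul1r -mulrDl nat1r /xlnx mulrA divff ?gt_eqF// mul1r.
by rewrite lnV ?posrE// /log2 natr1 invfM mulrN -mulrA [(ln 2)^-1 * _]mulrC.
Qed.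

(** The combination of the errors at the [n + 1] vertices with weight [1] and at the
    centroid with weight [- (n + 1)] kills affine functions, and equals
    [(n + 1) / 2 * log2 (n + 1)] for [negentropy]. *)
Lemma negentropy_approx_ge (P : mpoly.mpoly n R) : poly_deg_le 1 P ->
  ((1 / 4 * log2 (n%:R + 1))%:E <=
    sup_norm simplex (fun x => negentropy x - mpoly_fun P x)%R)%E.
Proof.
move=> /mpoly_fun_affine[a [b Pab]]; rewrite leNgt; apply/negP => lt_sup.
pose N : R := n.+1%:R; have N0 : 0 < N by rewrite ltr0n.
have nE : n%:R = N - 1 :> R by rewrite /N -natr1; lra.
pose D x := negentropy x - mpoly_fun P x.
set q := 1 / 4 * _ in lt_sup.
have Dq x : simplex x -> `|D x| < q.
  move=> Kx; rewrite -lte_fin; apply: le_lt_trans lt_sup.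
  by apply: ereal_sup_ubound; exists x.
have K0 : simplex 0.
  by split=> [i|]; rewrite ?mxE// big1// => i _; rewrite mxE.
have Kd i : simplex (delta_mx 0 i).
  split=> [j|]; first by rewrite mxE ler0n.
  by rewrite (bigD1 i)//= big1 => [|j ji]; rewrite mxE !eqxx ?addr0// (negbTE ji).
have Kc : simplex (const_mx N^-1).
  split=> [i|]; first by rewrite mxE invr_ge0 ltW.
  under eq_bigr do rewrite mxE.
  rewrite sumr_const card_ord -[_ *+ n]mulr_natl ler_pdivrMr// mul1r nE; lra.
have P0 : mpoly_fun P 0 = a.
  by rewrite Pab big1 ?addr0// => i _; rewrite mxE mulr0.
have Pd i : mpoly_fun P (delta_mx 0 i) = a + b i.
  rewrite Pab (bigD1 i)//= big1 => [|j ji]; rewrite mxE !eqxx ?mulr1 ?addr0//.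
  by rewrite (negbTE ji) mulr0.
have Pc : N * mpoly_fun P (const_mx N^-1) = N * a + \sum_i b i.
  rewrite Pab mulrDr mulr_sumr; congr (_ + _); apply: eq_bigr => i _.
  by rewrite mxE mulrCA divff ?mulr1// gt_eqF.
have gapE : D 0 + \sum_i D (delta_mx 0 i) - N * D (const_mx N^-1) = 2 * N * q.
  rewrite /D negentropy_vertex0 negentropy_centroid P0.
  under eq_bigr do rewrite negentropy_vertex Pd sub0r.
  rewrite sumrN big_split /= sumr_const card_ord -[a *+ n]mulr_natl nE.
  rewrite [N * (_ - _)]mulrBr Pc /q nE; move: (log2 _) => l; lra.
have := Dq _ K0; have := Dq _ Kc; rewrite !ltr_norml => /andP[Dc _] /andP[_ D0].
have Dsum : \sum_i D (delta_mx 0 i) <= (N - 1) * q.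
  rewrite -nE mulr_natl -[n in leRHS]card_ord -sumr_const; apply: ler_sum => i _.
  by have := Dq _ (Kd i); rewrite ltr_norml => /andP[_ /ltW].
have : N * - q <= N * D (const_mx N^-1) by rewrite ler_pM2l// ltW.
lra.
Qed.

Lemma global_convex_whitney_ge :
  ((1 / 4 * log2 (n%:R + 1))%:E <= global_convex_whitney R 2 n)%E.
Proof.
apply: (@le_trans _ _ (best_approx 1 simplex negentropy)).
  by apply: le_ereal_inf_tmp => _ [P P1 <-]; exact: negentropy_approx_ge.
apply: (@le_trans _ _ (convex_whitney 2 simplex)); last first.
  apply: ereal_sup_ubound; exists simplex => //; split.
  - exact: simplex_compact.
  - exact: simplex_convex.
  - exact: simplex_interior.
apply: ereal_sup_ubound; exists negentropy => //; split; first split.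
- by apply: continuous_subspaceT; exact: continuous_negentropy.
- by move=> x y Kx Ky; have /andP[] := negentropy_second_difference x y Kx Ky; lra.
apply: ge_ereal_sup => _ [[x h] /= Kxh <-]; rewrite lee_fin.
have Kx := Kxh 0%N isT; have Ky := Kxh 2%N isT; rewrite mulr0n addr0 in Kx.
have := negentropy_second_difference _ _ Kx Ky.
have -> : 2^-1 *: (x + (x + h *+ 2)) = x + h.
  by rewrite addrA -mulr2n -mulrnDl -[(x + h) *+ 2]scaler_nat scalerA mulVf// scale1r.
rewrite /finite_diff !big_ord_recl big_ord0 /= /bump /= !addn0 /= mulr0n addr0 mulr1n.
have -> : (1 + 1)%N = 2%N by [].
rewrite bin1 expr0 expr1 sqrrN expr1n ler_norml => /andP[h0 h1].
lra.
Qed.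
End Simplex.

(** * Asymptotics *)

Section Log2.
Context {R : realType}.

Let ln2_gt0 : 0 < ln (2 : R). Proof. by rewrite ln_gt0//; lra. Qed.

Lemma le_log2 (a b : R) : 0 < a -> a <= b -> log2 a <= log2 b.
Proof.
move=> a0 ab; rewrite /log2 ler_pM2r ?invr_gt0// ler_ln ?posrE//.
exact: lt_le_trans ab.
Qed.

Lemma log2_exp k : log2 (2 ^+ k : R) = k%:R.
Proof. by rewrite /log2 lnXn// -[_ *+ k]mulr_natl mulfK// gt_eqF. Qed.

Lemma trunc_log_le_floor_log2 n : (0 < n)%N ->
  (trunc_log 2 n)%:R <= (Num.floor (log2 (n%:R : R)))%:~R :> R.
Proof.
move=> n0; rewrite -[leLHS]/((trunc_log 2 n : int)%:~R) ler_int floor_ge_int.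
rewrite -[leLHS]/((trunc_log 2 n)%:R) -[leLHS]log2_exp.
by apply: le_log2; rewrite ?exprn_gt0// -natrX ler_nat trunc_logP.
Qed.

Lemma cvg_log2_nat : (fun n => log2 (n%:R : R)) @ \oo --> +oo.
Proof.
apply/cvgryPge => A; near=> n.
have n0 : 0 < n%:R :> R by rewrite ltr0n; near: n; exact: nbhs_infty_gt.
rewrite /log2 ler_pdivlMr// -ler_expR lnK ?posrE//.
by near: n; exact: nbhs_infty_ger.
Unshelve. all: by end_near. Qed.
End Log2.

Theorem theorem1p2 (R : realType) :
  (forall n : nat, (0 < n)%N ->
     ((1 / 4 * log2 (n%:R + 1))%:E <= global_convex_whitney R 2 n
      <= (1 / 4 * (Num.floor (log2 (n%:R : R)))%:~R + 3 / 4)%:E)%E)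
  /\ (fun n : nat => global_convex_whitney R 2 n / (log2 (n%:R))%:E)%E @ \oo
       --> ((1 / 4 : R)%:E).
Proof.
have bounds n : (0 < n)%N ->
    ((1 / 4 * log2 (n%:R + 1))%:E <= global_convex_whitney R 2 n
      <= (1 / 4 * (Num.floor (log2 (n%:R : R)))%:~R + 3 / 4)%:E)%E.
  move=> n0; rewrite global_convex_whitney_ge /=.
  apply: (le_trans (global_convex_whitney_le R n _ (trunc_log_ltn n (ltnSn 1)))).
  rewrite lee_fin -[(trunc_log 2 n).+1%:R]natr1.
  have := trunc_log_le_floor_log2 (R := R) n n0.
  by move: (_%:~R) (_%:R) => u v; lra.
split=> //.
have upper0 : (fun n => 1 / 4 + 3 / 4 * (log2 (n%:R : R))^-1) @ \oo --> (1 / 4 : R).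
  rewrite -[X in _ --> X]addr0 -[X in _ + X](mulr0 (3 / 4)).
  apply: cvgD; first exact: cvg_cst.
  apply: cvgM; first exact: cvg_cst.
  apply/gtr0_cvgV0; last exact: cvg_log2_nat.
  near=> n; apply: (@lt_le_trans _ _ 1) => //.
  by near: n; exact: (cvgryPge _).1 cvg_log2_nat 1.
apply: (squeeze_cvge (f := fun=> (1 / 4)%:E)
  (h := fun n => (1 / 4 + 3 / 4 * (log2 (n%:R : R))^-1)%:E)).
- near=> n.
  have n0 : (0 < n)%N by near: n; exact: nbhs_infty_gt.
  have n0R : 0 < n%:R :> R by rewrite ltr0n.
  have l0 : 0 < log2 (n%:R : R).
    apply: (@lt_le_trans _ _ 1) => //.
    by near: n; exact: (cvgryPge _).1 cvg_log2_nat 1.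
  have /andP[lo hi] := bounds n n0.
  rewrite inver gt_eqF//; apply/andP; split.
    rewrite lee_pdivlMr//; apply: le_trans lo; rewrite lee_fin.
    by rewrite ler_pM2l//; apply: le_log2 => //; lra.
  rewrite lee_pdivrMr// -EFinM; apply: (le_trans hi); rewrite lee_fin.
  have := floor_le (log2 (n%:R : R)).
  move: (log2 _) (Num.floor _)%:~R l0 => l k l0 kl.
  have : l^-1 * l = 1 by rewrite mulVf// gt_eqF.
  lra.
- exact: cvg_cst.
- by apply: cvg_EFin; [exact: nearW | exact: upper0].
Unshelve. all: by end_near.
Qed.
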